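(* Let $1\le p<n$, let $F_1,\ldots,F_p\in\mathbb{Q}[X_1,\ldots,X_n]$ be a reduced regular sequence generating the ideal of definition of the affine variety $S=\{F_1=\cdots=F_p=0\}\subset\mathbb{C}^n$, and let $S_{\mathbb{R}}=S\cap\mathbb{R}^n$. Let $1\le i\le n-p$, let $U\subset\mathbb{C}^{(n-p-i+1)\times n}$ be a non-empty Zariski open set of full-rank matrices (a genericity condition), and let $C$ be a connected component of $S_{\mathbb{R}}$ containing a regular point of $S$. Then there exists a subset $O^{(i)}_C$ of $\mathbb{R}^{(n-p-i+1)\times n}$, non-empty and open in the Euclidean topology, such that every matrix $a\in O^{(i)}_C$ has maximal rank $n-p-i+1$, the real dual polar variety $W_{\overline{K}(\overline{a})}(S_{\mathbb{R}})$ is generic (i.e. $a\in U$), and $W_{\overline{K}(\overline{a})}(S_{\mathbb{R}})$ contains a regular point of $S$ lying in $C$.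
   Context: $J(F_1,\ldots,F_p)=[\partial F_k/\partial X_l]$ is the $p\times n$ Jacobian matrix. ''Reduced regular sequence'' means a regular sequence such that the ideals $(F_1,\ldots,F_k)$, $1\le k\le p$, are radical; $S$ is then non-empty of pure codimension $p$. A point of $S$ is called regular if $J(F_1,\ldots,F_p)$ has rank $p$ there; $S_{reg}$ is the set of regular points. For a matrix $a=[a_{k,l}]\in\mathbb{C}^{(n-p-i+1)\times n}$ of maximal rank, the $i$th dual polar variety $W_{\overline{K}(\overline{a})}(S)$ is the Zariski closure of the set of those points of $S_{reg}$ at which all $(n-i+1)$-minors of the $(n-i+1)\times n$ matrix whose first $p$ rows are $J(F_1,\ldots,F_p)$ and whose remaining rows are $(a_{k,1}-X_1,\ldots,a_{k,n}-X_n)$, $1\le k\le n-p-i+1$, vanish. For real $a$, $W_{\overline{K}(\overline{a})}(S_{\mathbb{R}}):=W_{\overline{K}(\overline{a})}(S)\cap\mathbb{R}^n$. In the paper, ''generic'' polar variety means that the defining matrix $a$ lies in a suitable non-empty Zariski open set of full-rank matrices on which the properties under consideration hold; here this set is denoted $U$. *)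

(* Defs.v *)
(* R^n and R^(m x n) carry the (Euclidean) matrix topology of
   mathcomp-analysis, and complex space is built on R[i] for R : realType. *)
From mathcomp Require Import all_boot all_order all_algebra.
From mathcomp Require Import all_classical all_reals.
From mathcomp Require Import topology normedtype.
From mathcomp Require Import complex.
(* The notations of mpoly clash with those of mathcomp-analysis. *)
From mathcomp Require Import -(notations) mpoly.

Set Implicit Arguments.
Unset Strict Implicit.
Unset Printing Implicit Defensive.

Import Order.TTheory GRing.Theory Num.Theory.
Import numFieldNormedType.Exports.

Local Open Scope classical_set_scope.
Local Open Scope ring_scope.

(* {mpoly K[n]} *)
Notation poly_in n K := (mpoly.mpoly n K).

Definition peval (K : comNzRingType) (n : nat) (f : poly_in n K)
    (x : 'rV[K]_n) : K :=
  mpoly.meval (fun l => x 0 l) f.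

Definition qeval (R : realType) (n : nat) (f : poly_in n rat)
    (x : 'rV[R[i]]_n) : R[i] :=
  peval (mpoly.map_mpoly (ratr : rat -> R[i]) f) x.

Definition complexify (R : realType) (m n : nat) (A : 'M[R]_(m, n)) :
    'M[R[i]]_(m, n) :=
  map_mx (real_complex R) A.

(* The ideal of Q[X_1, ..., X_n] generated by F 0, ..., F (k - 1). *)
Definition ideal_first (n p : nat) (F : 'I_p -> poly_in n rat) (k : nat) :
    set (poly_in n rat) :=
  [set f | exists G : 'I_p -> poly_in n rat,
     f = \sum_(j < p | (j < k)%N) G j * F j].

Definition radical_ideal (n : nat) (I : set (poly_in n rat)) : Prop :=
  forall (f : poly_in n rat) (e : nat), I (f ^+ e) -> I f.

(* F k is a non-zero-divisor modulo the preceding polynomials, and the whole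
   ideal is proper. *)
Definition regular_sequence (n p : nat) (F : 'I_p -> poly_in n rat) : Prop :=
  (forall (k : 'I_p) (g : poly_in n rat),
     ideal_first F k (g * F k) -> ideal_first F k g) /\
  ~ ideal_first F p 1.

Definition reduced_regular_sequence (n p : nat)
    (F : 'I_p -> poly_in n rat) : Prop :=
  regular_sequence F /\
  (forall k : nat, (1 <= k <= p)%N -> radical_ideal (ideal_first F k)).

Definition variety (R : realType) (n p : nat) (F : 'I_p -> poly_in n rat) :
    set 'rV[R[i]]_n :=
  [set x | forall k : 'I_p, qeval (F k) x = 0].

Definition real_variety (R : realType) (n p : nat)
    (F : 'I_p -> poly_in n rat) : set 'rV[R]_n :=
  [set x | variety F (complexify x)].

(* The ideal of definition is taken in Q[X_1, ..., X_n]. *)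
Definition ideal_of_definition (R : realType) (n : nat)
    (S : set 'rV[R[i]]_n) : set (poly_in n rat) :=
  [set f | forall x : 'rV[R[i]]_n, S x -> qeval f x = 0].

Definition jacobian (R : realType) (n p : nat) (F : 'I_p -> poly_in n rat)
    (x : 'rV[R[i]]_n) : 'M[R[i]]_(p, n) :=
  \matrix_(k < p, l < n) qeval (mpoly.mderiv l (F k)) x.

Definition regular_points (R : realType) (n p : nat)
    (F : 'I_p -> poly_in n rat) : set 'rV[R[i]]_n :=
  [set x | variety F x /\ \rank (jacobian F x) = p].

Definition zariski_closed (K : fieldType) (N : nat) (Z : set 'rV[K]_N) : Prop :=
  exists I : set (poly_in N K), Z = [set x | forall f, I f -> peval f x = 0].

Definition zariski_closure (K : fieldType) (N : nat) (A : set 'rV[K]_N) :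
    set 'rV[K]_N :=
  \bigcap_(Z in [set Z : set 'rV[K]_N | zariski_closed Z /\ A `<=` Z]) Z.

(* The affine space of m x n matrices is identified with K^(m * n). *)
Definition zariski_open_mx (K : fieldType) (m n : nat) (U : set 'M[K]_(m, n)) :
    Prop :=
  zariski_closed [set v : 'rV[K]_(m * n) | ~ U (vec_mx v)].

Definition polar_matrix (R : realType) (n p m : nat)
    (F : 'I_p -> poly_in n rat) (a : 'M[R[i]]_(m, n)) (x : 'rV[R[i]]_n) :
    'M[R[i]]_(p + m, n) :=
  col_mx (jacobian F x) (\matrix_(k < m, l < n) (a k l - x 0 l)).

Definition maximal_minors_vanish (K : fieldType) (q n : nat)
    (M : 'M[K]_(q, n)) : Prop :=
  forall s : 'I_q -> 'I_n, {homo s : j k / (j < k)%N} -> \det (colsub s M) = 0.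

(* In the i-th dual polar variety, m = n - p - i + 1, so that p + m = n - i + 1
   and the minors of size p + m are the (n - i + 1)-minors. *)
Definition dual_polar_variety (R : realType) (n p m : nat)
    (F : 'I_p -> poly_in n rat) (a : 'M[R[i]]_(m, n)) : set 'rV[R[i]]_n :=
  zariski_closure
    [set x | regular_points F x /\ maximal_minors_vanish (polar_matrix F a x)].

Definition real_dual_polar_variety (R : realType) (n p m : nat)
    (F : 'I_p -> poly_in n rat) (a : 'M[R]_(m, n)) : set 'rV[R]_n :=
  [set x | dual_polar_variety F (complexify a) (complexify x)].

Definition is_connected_component (T : topologicalType) (A C : set T) : Prop :=
  exists2 x, A x & C = connected_component A x.

(* Main.v *)
(** Let x be a regular real point of C. Only the row k0 of a matters: if a real
    point y of S minimises the distance to a_k0 locally on S_R, then a_k0 - y is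
    a combination of the gradients of the F_k at y, so all the maximal minors of
    the polar matrix vanish at y. Let K be the intersection of S_R with a small
    box around x in which the real points of S are regular, and let a_k0 be
    close to x. On every subset D of K that contains x and is clopen in K, a
    point of D closest to a_k0 lies in the interior of the box, hence is such a
    y. The zero set of the minors is closed and meets all these D; by
    compactness it meets their intersection, which is the connected component of
    x in K and lies in C. This avoids the local connectedness of S_R at its
    regular points, and the penalty method replaces the implicit function
    theorem in the Lagrange multiplier rule. Finally, a non-empty Zariski open
    set of complex matrices contains an open dense set of real ones. *)

From mathcomp Require Import derive.
Require Import Defs.
From mathcomp Require Import all_boot all_order all_algebra.
From mathcomp Require Import all_classical all_reals.
From mathcomp Require Import topology normedtype.
From mathcomp Require Import complex.
From mathcomp Require Import -(notations) mpoly.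
From mathcomp Require Import ring lra.
Set Implicit Arguments.
Unset Strict Implicit.
Unset Printing Implicit Defensive.
Import Order.TTheory GRing.Theory Num.Theory.
Import numFieldNormedType.Exports.
Local Open Scope classical_set_scope.
Local Open Scope ring_scope.

(** * Connected components of compact sets through clopen subsets *)

Section QuasiComponent.
Variables (R : realType) (T : topologicalType) (K : set T) (x : T).
Hypotheses (hT : hausdorff_space T) (nT : normal_space T) (cK : compact K).
Hypothesis Kx : K x.

(** As [K] is closed in the Hausdorff space [T], these are the relatively clopen subsets of [K]
    around [x], expressed without a subspace topology. *)
Let clopen_part : set (set T) :=
  [set D | [/\ D `<=` K, D x, closed D & closed (K `\` D)]].

Let clopen_partI D E : clopen_part D -> clopen_part E -> clopen_part (D `&` E).
Proof.
move=> [DK Dx cD cKD] [EK Ex cE cKE]; split => //.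
- by move=> y [/DK].
- exact: closedI.
- by rewrite setDIr; exact: closedU.
Qed.

Let clopen_partK : clopen_part K.
Proof.
by split => //; [exact: compact_closed|rewrite setDv; exact: closed0].
Qed.

Let quasi_component := \bigcap_(D in clopen_part) D.

(** The sets [D] [&] [Z] are stable under intersection, so they generate a proper filter on the
    compact [K]. Being closed, they all contain any of its cluster points. *)
Let meets_quasi_component (Z : set T) : closed Z ->
  (forall D, clopen_part D -> D `&` Z !=set0) -> quasi_component `&` Z !=set0.
Proof.
move=> cZ meetZ.
pose G := filter_from clopen_part (fun D => D `&` Z).
have PG : ProperFilter G.
  apply: filter_from_proper => //; apply: filter_from_filter.
    by exists K; exact: clopen_partK.
  move=> D E pD pE; exists (D `&` E); first exact: clopen_partI.
  by move=> y [[Dy Ey] Zy].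
have GK : G K by exists K; [exact: clopen_partK|move=> y []].
have [y [Ky]] := cK PG GK; rewrite clusterE => cly.
have DZy D : clopen_part D -> (D `&` Z) y.
  move=> pD; have [_ _ cD _] := pD.
  have /closure_id -> : closed (D `&` Z) by exact: closedI.
  by apply: cly; exists D.
exists y; split; first by move=> D /DZy[].
by have [] := DZy _ clopen_partK.
Qed.

(** On [D], lying in [U] amounts to avoiding the open set [V], which makes the trace of [U]
    closed. *)
Let clopen_part_split (D U V : set T) : clopen_part D -> open U -> open V ->
  U `&` V = set0 -> D `<=` U `|` V -> U x -> clopen_part (D `&` U).
Proof.
move=> [DK Dx cD cKD] oU oV UV0 DUV Ux; split => //.
- by move=> y [/DK].
- have -> : D `&` U = D `&` ~` V.
    apply/seteqP; split => y [Dy] => [Uy|nVy]; split => //.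
      by move=> Vy; have : (U `&` V) y by []; rewrite UV0.
    by have [] := DUV _ Dy.
  by apply: closedI => //; exact: open_closedC.
- rewrite setDIr; apply: closedU => //; rewrite setDE.
  by apply: closedI; [exact: compact_closed|exact: open_closedC].
Qed.

(** Normality separates a clopen subset [B] of the quasi-component from its complement by open [U]
    and [V]. By [meets_quasi_component] some clopen part lies in their union. Its half around [x] is
    again a clopen part, so it contains the whole quasi-component, and nothing is left for the other
    half. *)
Let quasi_component_connected : connected quasi_component.
Proof.
have cQ : closed quasi_component.
  by apply: closed_bigI => D [].
have Qx : quasi_component x by move=> D [].
move=> B [b Bb] [A1 oA1 BA1] [A2 cA2 BA2].
have cB : closed B by rewrite BA2; exact: closedI.
have cQB : closed (quasi_component `\` B).
  have -> : quasi_component `\` B = quasi_component `&` ~` A1.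
    rewrite BA1; apply/seteqP; split => y [Qy nBy]; split => //.
      by move=> A1y; apply: nBy.
    by move=> [_].
  by apply: closedI => //; exact: open_closedC.
have BQB : B `&` (quasi_component `\` B) = set0.
  by apply/seteqP; split => y // [? []].
have [U [V [oU oV BU QBV UV0]]] :=
  (@normal_openP R T).1 nT _ _ cB cQB BQB.
have [D pD DUV] : exists2 D, clopen_part D & D `<=` U `|` V.
  apply: contrapT => nD.
  have [||y [Qy]] := @meets_quasi_component (~` (U `|` V)).
  - by apply: open_closedC; exact: openU.
  - move=> D pD; apply: contrapT => DUV; apply: nD; exists D => // y Dy.
    by apply: contrapT => nUV; apply: DUV; exists y.
  - apply; have [/BU Uy|nBy] := pselect (B y); first by left.
    by right; exact: QBV.
have BQ : B `<=` quasi_component by rewrite BA1 => y [].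
apply/seteqP; split => // y Qy; apply: contrapT => nBy.
have [/BU Ux|nBx] := pselect (B x).
- have pDU := clopen_part_split pD oU oV UV0 DUV Ux.
  have : (U `&` V) y by split; [case: (Qy _ pDU)|exact: QBV].
  by rewrite UV0.
- have Vx : V x by exact: QBV.
  rewrite setIC in UV0; rewrite setUC in DUV.
  have pDV := clopen_part_split pD oV oU UV0 DUV Vx.
  have : (V `&` U) b by split; [case: (BQ _ Bb _ pDV)|exact: BU].
  by rewrite UV0.
Qed.

(* In a compact Hausdorff space the component of x is the intersection of the
   clopen sets containing x. *)
Lemma component_meets_closed (Z : set T) : closed Z ->
  (forall D, D `<=` K -> D x -> closed D -> closed (K `\` D) ->
     D `&` Z !=set0) ->
  connected_component K x `&` Z !=set0.
Proof.
move=> cZ meetZ.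
have [|y [Qy Zy]] := meets_quasi_component cZ.
  by move=> D [DK Dx cD cKD]; exact: meetZ.
exists y; split => //; exists quasi_component => //; split => //.
- by move=> D [].
- by move=> z /(_ _ clopen_partK).
Qed.

End QuasiComponent.

(** * Polynomials under ring morphisms, along lines, and as continuous functions *)

Lemma peval_map (K L : comNzRingType) (f : {rmorphism K -> L}) n
    (P : poly_in n K) (x : 'rV[K]_n) :
  peval (mpoly.map_mpoly f P) (map_mx f x) = f (peval P x).
Proof.
rewrite /peval; elim/mpolyind: P => [|c m P _ _ IH].
  by rewrite !(rmorph0, meval0).
rewrite !(rmorphD, mevalD) /= IH map_mpolyZ map_mpolyX !mevalZ !rmorphM !mevalX.
rewrite rmorph_prod; congr (_ * _ + _).
by apply: eq_bigr => l _; rewrite mxE rmorphXn.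
Qed.

Lemma mderiv_map (K L : comNzRingType) (f : {rmorphism K -> L}) n
    (P : poly_in n K) (l : 'I_n) :
  mpoly.mderiv l (mpoly.map_mpoly f P) = mpoly.map_mpoly f (mpoly.mderiv l P).
Proof.
apply/mpolyP => m.
by rewrite mcoeff_deriv !mcoeff_map_mpoly mcoeff_deriv raddfMn.
Qed.

(** The property holds for constants and variables and passes to sums and products. It reduces both
    the first-order condition at a minimum and the search for real points of Zariski open sets to
    one variable. *)
Lemma poly_line (K : comNzRingType) n (P : poly_in n K) (x v : 'rV[K]_n) :
  exists q : {poly K}, (forall t, q.[t] = peval P (x + t *: v)) /\
    q^`().[0] = \sum_l v 0 l * peval (mpoly.mderiv l P) x.
Proof.
pose line P := exists q : {poly K}, (forall t, q.[t] = peval P (x + t *: v)) /\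
    q^`().[0] = \sum_l v 0 l * peval (mpoly.mderiv l P) x.
have lineC c : line (mpoly.mpolyC n c).
  exists c%:P; split=> [t|]; first by rewrite hornerC /peval mevalC.
  rewrite derivC horner0 big1 // => l _.
  by rewrite mderivC /peval meval0 mulr0.
have lineX i : line (mpoly.mpolyX K (mpoly.mnm1 i)).
  exists ((x 0 i)%:P + v 0 i *: 'X); split=> [t|].
    by rewrite !hornerE /peval mevalXU !mxE mulrC.
  rewrite derivD derivC add0r derivZ derivX alg_polyC hornerC.
  rewrite (bigD1 i) //= big1 => [|l li].
    rewrite addr0 mderivX mnm1E eqxx scale1r.
    rewrite /peval (_ : mnm_sub _ _ = mnm0) ?mpolyX0 ?meval1 ?mulr1 //.
    by apply/mnmP => j; rewrite mnmBE subnn mnm0E.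
  by rewrite mderivX mnm1E eq_sym (negbTE li) scale0r /peval meval0 mulr0.
have lineD P1 P2 : line P1 -> line P2 -> line (P1 + P2).
  move=> [q1 [q1E dq1]] [q2 [q2E dq2]]; exists (q1 + q2); split=> [t|].
    by rewrite hornerD q1E q2E /peval mevalD.
  rewrite derivD hornerD dq1 dq2 -big_split; apply: eq_bigr => l _ /=.
  by rewrite mderivD /peval mevalD mulrDr.
have lineM P1 P2 : line P1 -> line P2 -> line (P1 * P2).
  move=> [q1 [q1E dq1]] [q2 [q2E dq2]]; exists (q1 * q2); split=> [t|].
    by rewrite hornerM q1E q2E /peval mevalM.
  rewrite derivM hornerD !hornerM dq1 dq2 q1E q2E scale0r addr0.
  rewrite mulr_suml mulr_sumr -big_split; apply: eq_bigr => l _ /=.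
  rewrite mderivM /peval mevalD !mevalM mulrDr !mulrA; congr (_ + _).
  by rewrite -!mulrA mulrCA.
have lineXm m : line (mpoly.mpolyX K m).
  rewrite mpolyXE_id; apply: big_ind => // [|i _]; first exact: (lineC 1).
  elim: (m i) => [|k IH]; first by rewrite expr0; exact: (lineC 1).
  by rewrite exprS; apply: lineM.
rewrite -/(line P); elim/mpolyind: P => [|c m P _ _ IH].
  by have := lineC 0; rewrite raddf0.
by apply: lineD => //; rewrite -mul_mpolyC; exact: lineM.
Qed.

(** The map [h] allows for polynomials in the entries of a matrix, read through [mxvec] or [row]. *)
Lemma peval_continuous (R : realType) (T : topologicalType) n
    (P : poly_in n R) (h : T -> 'rV[R]_n) :
  (forall l, continuous (fun y => h y 0 l)) ->
  continuous (fun y => peval P (h y)).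
Proof.
move=> ch; rewrite /peval; elim/mpolyind: P => [|c m P _ _ IH] y.
  by under eq_fun do rewrite meval0; exact: cvg_cst.
under eq_fun do rewrite mevalD mevalZ mevalX.
apply: cvgD; last exact: IH.
apply: cvgM; first exact: cvg_cst.
have cX : continuous (fun y => \prod_(l < n) h y 0 l ^+ m l).
  apply: (@continuous_big R _ *%R) => [|l _ z]; first exact: mul_continuous.
  elim: (m l) => [|k IHk].
    by under eq_fun do rewrite expr0; exact: cvg_cst.
  by under eq_fun do rewrite exprS; apply: cvgM => //; exact: ch.
exact: cX.
Qed.

Lemma peval_rV_continuous (R : realType) n (P : poly_in n R) :
  continuous (peval P : 'rV[R]_n -> R).
Proof.
by apply: (@peval_continuous _ _ _ _ id) => l; exact: coord_continuous.
Qed.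

(** * First-order conditions at minima *)

Lemma peval_gt_near (R : realType) n (P : poly_in n R) (x : 'rV[R]_n) (c : R) :
  c < peval P x -> \forall y \near x, c < peval P y.
Proof. by move=> cP; exact: (@peval_rV_continuous _ _ P x _ (lt_nbhsr cP)). Qed.

(** Fermat's rule in one variable, applied to the restriction of [P] to a coordinate line through
    [x]. *)
Lemma local_min_mderiv0 (R : realType) n (P : poly_in n R) (x : 'rV[R]_n) :
  (\forall y \near x, peval P x <= peval P y) ->
  forall l, peval (mpoly.mderiv l P) x = 0.
Proof.
move=> /nbhs_ballP[e /= e0 minx] l.
have [q [qE dq]] := poly_line P x (delta_mx 0 l).
have <- : q^`().[0] = peval (mpoly.mderiv l P) x.
  rewrite dq (bigD1 l) //= big1 => [|j jl].
    2: by rewrite !mxE (negbTE jl) mul0r.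
  by rewrite addr0 !mxE !eqxx mul1r.
have itv0 : (0 : R) \in `]- e, e[ by rewrite in_itv /= oppr_lt0 e0.
rewrite derive.derivE derive1E.
suff min0 t : t \in `]- e, e[ -> q.[0] <= q.[t].
  have [|t _|_ ->//] := derive1_at_min (f := horner q) _ _ itv0 min0.
    by rewrite ge0_cp // ltW.
  exact: derivable_horner.
rewrite in_itv /= => te.
rewrite !qE scale0r addr0; apply: minx; split=> // i j.
rewrite /ball /= ord1 !mxE opprD addrA subrr add0r normrN.
apply: le_lt_trans (_ : `|t| < e); last by rewrite ltr_norml.
by rewrite normrM ler_piMr // normr_nat lern1 leq_b1.
Qed.

(* The penalty method: a minimiser of Q + N (f_1^2 + ... + f_p^2) on L that is
   interior to L satisfies the Lagrange condition with multipliers -2 N f_k;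
   the asserted z is a cluster point of such minimisers as N grows. *)
Lemma penalty_limit (R : realType) n p (Q : poly_in n R)
    (f : 'I_p -> poly_in n R) (L U : set 'rV[R]_n) (x : 'rV[R]_n) :
  compact L -> open U -> U `<=` L -> L x -> (forall k, peval (f k) x = 0) ->
  (forall z, 0 <= peval Q z) ->
  (forall z, L z -> (forall k, peval (f k) z = 0) ->
     peval Q z <= peval Q x -> U z) ->
  exists z, [/\ L z, forall k, peval (f k) z = 0, peval Q z <= peval Q x &
    forall W, nbhs z W -> exists2 y, W y & exists c : 'I_p -> R,
      forall l, peval (mpoly.mderiv l Q) y =
                \sum_k c k * peval (mpoly.mderiv l (f k)) y].
Proof.
move=> cL oU UL Lx fx Q0 LU.
pose P (N : nat) : poly_in n R := Q + N%:R *: \sum_k f k ^+ 2.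
have PE N y : peval (P N) y = peval Q y + N%:R * \sum_k peval (f k) y ^+ 2.
  rewrite /peval mevalD mevalZ raddf_sum /=; congr (_ + _ * _).
  by apply: eq_bigr => k _; rewrite rmorphXn.
have /choice[z zmin] N :
    exists z, L z /\ forall y, L y -> peval (P N) z <= peval (P N) y.
  have [||y Ly miny] := @compact_EVT_min _ R (peval (P N)) L _ cL.
  - by exists x.
  - by apply: continuous_subspaceT; exact: peval_rV_continuous.
  - by exists y; split=> [|t Lt]; [exact: set_mem|apply: miny; exact: mem_set].
(* The penalty vanishes at [x], so comparison with [x] gives a bound independent of [N]. *)
have Pz N : peval Q (z N) + N%:R * \sum_k peval (f k) (z N) ^+ 2 <= peval Q x.
  have [_ /(_ _ Lx)] := zmin N; rewrite !PE.
  rewrite [X in _ <= _ + _ * X]big1 ?mulr0 ?addr0 // => k _.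
  by rewrite fx expr0n.
have sum_ge0 y : 0 <= \sum_k peval (f k) y ^+ 2.
  by apply: sumr_ge0 => k _; exact: sqr_ge0.
have Qz N : peval Q (z N) <= peval Q x.
  by apply: le_trans (Pz N); rewrite lerDl mulr_ge0.
have [w [Lw clw]] : L `&` cluster (z @ \oo) !=set0.
  by apply: cL; exists 0%N => // N _; exact: (zmin N).1.
have clz (A : set 'rV[R]_n) (N : nat) :
    nbhs w A -> exists2 M, (N <= M)%N & A (z M).
  move=> wA.
  have [||_ [[M /= NM <-] AzM]] := clw (z @` [set M | (N <= M)%N]) A => //.
    by exists N => // M NM; exists M.
  by exists M.
(* Otherwise the square of [f k] exceeds [e] near [w], and at some [z M] with [M] at least [N] the
   penalty exceeds [N * e], hence the value of [Q] at [x], against [Pz]. *)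
have fw k : peval (f k) w = 0.
  apply: contrapT => /eqP fkw; pose e := peval (f k) w ^+ 2 / 2.
  have e0 : 0 < e by rewrite divr_gt0 // exprn_even_gt0.
  have [N Ne] : exists N : nat, peval Q x / e < N%:R.
    exists (Num.bound (peval Q x / e)); apply: archi_boundP.
    by rewrite divr_ge0 // ltW.
  have [|M NM /=] := @clz [set y | e < peval (f k ^+ 2) y] N.
    apply: peval_gt_near.
    rewrite /peval rmorphXn /= -/(peval _ _) /e ltr_pdivrMr // mulr_natr.
    by rewrite mulr2n ltrDl exprn_even_gt0.
  rewrite /peval rmorphXn /= -/(peval _ _) => efM.
  have : peval Q x < N%:R * e by rewrite -ltr_pdivrMr.
  rewrite ltNge => /negP; apply; apply: le_trans (Pz M).
  apply: le_trans (_ : M%:R * e <= _).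
    by rewrite ler_wpM2r ?ler_nat // ltW.
  apply: le_trans (_ : M%:R * \sum_k peval (f k) (z M) ^+ 2 <= _).
    2: by rewrite lerDr.
  rewrite ler_wpM2l // (bigD1 k) //= (le_trans (ltW efM)) // lerDl.
  by apply: sumr_ge0 => j _; exact: sqr_ge0.
have Qw : peval Q w <= peval Q x.
  rewrite leNgt; apply/negP => Qxw.
  have [|M _ /=] := @clz [set y | peval Q x < peval Q y] 0.
    exact: peval_gt_near.
  by rewrite ltNge Qz.
exists w; split => // W wW.
(* Since [U] is open and inside [L], the minimisers close to [w] are unconstrained local minima,
   with vanishing gradient. *)
have Uw : nbhs w U by apply: open_nbhs_nbhs; split => //; exact: LU.
have [M _ [WM UM]] := clz _ 0 (filterI wW Uw).
exists (z M) => //; exists (fun k => - (2 * M%:R * peval (f k) (z M))) => l.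
have : peval (mpoly.mderiv l (P M)) (z M) = 0.
  apply: local_min_mderiv0; near=> y; apply: (zmin M).2; apply: UL; near: y.
  exact: open_nbhs_nbhs.
rewrite /P linearD linearZ linear_sum /= /peval mevalD mevalZ.
rewrite [meval _ (\sum_(k < p) _)]raddf_sum.
move/eqP; rewrite addr_eq0 => /eqP ->; rewrite mulr_sumr -sumrN.
apply: eq_bigr => k _; rewrite expr2 mderivM /= mevalD !mevalM /peval.
by ring.
Unshelve. all: by end_near. Qed.

(** * The polar matrix with polynomial entries, whose minors are then real polynomials *)

Definition polar_poly (R : comNzRingType) n p m (f : 'I_p -> poly_in n R)
    (a : 'M[R]_(m, n)) : 'M[poly_in n R]_(p + m, n) :=
  col_mx (\matrix_(k < p, l < n) mpoly.mderiv l (f k))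
    (\matrix_(k < m, l < n)
       (mpoly.mpolyC n (a k l) - mpoly.mpolyX R (mpoly.mnm1 l))).

Definition rat_poly (R : realType) n (P : poly_in n rat) : poly_in n R :=
  mpoly.map_mpoly (ratr : rat -> R) P.

Lemma qeval_complexify (R : realType) n (P : poly_in n rat) (x : 'rV[R]_n) :
  qeval P (complexify x) = (peval (rat_poly R P) x)%:C%C.
Proof.
have ratE : mpoly.map_mpoly (ratr : rat -> R[i]) P =
    mpoly.map_mpoly (real_complex R) (rat_poly R P).
  apply/mpolyP => t; rewrite /rat_poly !mcoeff_map_mpoly.
  exact/esym/(fmorph_rat (real_complex R)).
by rewrite /qeval ratE; exact: (peval_map (real_complex R)).
Qed.

Lemma jacobian_complexify (R : realType) n p (F : 'I_p -> poly_in n rat)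
    (x : 'rV[R]_n) :
  jacobian F (complexify x) =
  complexify
    (\matrix_(k < p, l < n) peval (mpoly.mderiv l (rat_poly R (F k))) x).
Proof. by apply/matrixP => k l; rewrite !mxE qeval_complexify mderiv_map. Qed.

Lemma polar_matrix_complexify (R : realType) n p m (F : 'I_p -> poly_in n rat)
    (a : 'M[R]_(m, n)) (x : 'rV[R]_n) :
  polar_matrix F (complexify a) (complexify x) =
  complexify (map_mx (mpoly.meval (fun l => x 0 l))
    (polar_poly (fun k => rat_poly R (F k)) a)).
Proof.
rewrite /polar_matrix /polar_poly /complexify !map_col_mx -/(complexify x).
rewrite jacobian_complexify; congr col_mx; apply/matrixP => k l.
  by rewrite !mxE.
rewrite !mxE.
by rewrite mevalB mevalC mevalXU rmorphB.
Qed.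

(** The vector with entries [c] on the Jacobian rows and -1 on row [k0] is nonzero and kills the
    polar matrix from the left, hence also every choice of its columns. *)
Lemma polar_minor_eq0 (R : idomainType) n p m (f : 'I_p -> poly_in n R)
    (a : 'M[R]_(m, n)) (k0 : 'I_m) (x : 'rV[R]_n) (c : 'I_p -> R) :
  (forall l, a k0 l - x 0 l = \sum_k c k * peval (mpoly.mderiv l (f k)) x) ->
  forall s, peval (\det (colsub s (polar_poly f a))) x = 0.
Proof.
move=> cE s; rewrite /peval -det_map_mx; apply/eqP/det0P.
exists (row_mx (\row_k c k) (- delta_mx 0 k0)).
  apply/eqP => /rowP/(_ (rshift p k0)); rewrite row_mxEr !mxE !eqxx /=.
  by move/eqP; rewrite oppr_eq0 oner_eq0.
rewrite map_mxsub mulmx_colsub /polar_poly map_col_mx mul_row_col mulNmx -rowE.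
apply/rowP => j; rewrite !mxE raddfB /= mevalC mevalXU cE; apply/eqP.
by rewrite subr_eq0; apply/eqP/eq_bigr => k _; rewrite !mxE.
Qed.

(** * Real points of Zariski open sets of complex matrices *)

Lemma complex_poly_parts (R : realType) n (f : poly_in n R[i]) :
  exists g h : poly_in n R, forall x,
    peval f (complexify x) = Complex (peval g x) (peval h x).
Proof.
elim/mpolyind: f => [|[a b] m P _ _ [g [h ghE]]].
  by exists 0, 0 => x; rewrite /peval !meval0.
exists (a *: mpoly.mpolyX R m + g), (b *: mpoly.mpolyX R m + h) => x.
have pevalDZ (K : comNzRingType) c (P1 P2 : poly_in n K) y :
    peval (c *: P1 + P2) y = c * peval P1 y + peval P2 y.
  by rewrite /peval mevalD mevalZ.
(* A monomial is real at a real point, so the real and imaginary parts [a] and [b] of its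
   coefficient separate. *)
rewrite !pevalDZ ghE -(map_mpolyX (real_complex R) m).
rewrite (peval_map (real_complex R)) /=.
by rewrite /GRing.add /GRing.mul /= !mulr0 subr0 add0r.
Qed.

Lemma zero_set_closed (R : realType) (T : topologicalType) n
    (P : poly_in n R) (h : T -> 'rV[R]_n) :
  (forall l, continuous (fun y => h y 0 l)) ->
  closed [set y | peval P (h y) = 0].
Proof.
move=> ch; rewrite -[X in closed X]/((fun y => peval P (h y)) @^-1` [set 0]).
by apply: preimage_closed => [y _|]; [exact: peval_continuous|exact: closed_eq].
Qed.

Lemma common_zeros_closed (R : realType) n (I : Type) (P : I -> poly_in n R) :
  closed [set y | forall j, peval (P j) y = 0].
Proof.
have -> : [set y | forall j, peval (P j) y = 0] =
    \bigcap_j [set y | peval (P j) y = 0].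
  by apply/seteqP; split => y yP j => [_|]; exact: yP.
apply: closed_bigI => j _; apply: (@zero_set_closed _ _ _ _ id) => l.
exact: coord_continuous.
Qed.

(** Each equation of the complement splits into two real polynomial equations, with Euclidean closed
    zero sets. *)
Lemma zariski_open_real_open (R : realType) m n (U : set 'M[R[i]]_(m, n)) :
  zariski_open_mx U -> open [set a : 'M[R]_(m, n) | U (complexify a)].
Proof.
move=> [I UI]; rewrite -closedC.
have -> : ~` [set a : 'M[R]_(m, n) | U (complexify a)] =
    \bigcap_(f in I) [set a | peval f (complexify (mxvec a)) = 0].
  apply/seteqP; split => a /=.
    move=> nUa f If; have : [set v | ~ U (vec_mx v)] (complexify (mxvec a)).
      by rewrite /= /complexify map_mxvec mxvecK.
    by rewrite UI; apply.
  move=> Ia; have : [set v | ~ U (vec_mx v)] (complexify (mxvec a)).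
    by rewrite UI => f /Ia.
  by rewrite /= /complexify map_mxvec mxvecK.
apply: closed_bigI => f _; have [g [h ghE]] := complex_poly_parts f.
have -> : [set a | peval f (complexify (mxvec a)) = 0] =
    [set a : 'M[R]_(m, n) | peval g (mxvec a) = 0] `&`
    [set a | peval h (mxvec a) = 0].
  apply/seteqP; split => a /=; rewrite ghE; first by move=> [].
  by move=> [-> ->].
have cv (l : 'I_(m * n)) : continuous (fun a : 'M[R]_(m, n) => mxvec a 0 l).
  case/mxvec_indexP: l => i j; under eq_fun do rewrite mxvecE.
  exact: coord_continuous.
by apply: closedI; exact: zero_set_closed.
Qed.

(** The points [e / k.+2] are infinitely many, and [q] has fewer roots than its size. The shift by 2
    keeps them strictly below the radius [e]. *)
Lemma poly_nonroot_near0 (R : realType) (q : {poly R[i]}) (W : set R) :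
  q != 0 -> nbhs 0 W -> exists2 t : R, W t & q.[t%:C%C] != 0.
Proof.
move=> q0 /nbhs_ballP[e /= e0 eW]; apply: contrapT => Wroot.
pose t k : R := e / k.+2%:R.
have Wt k : W (t k).
  apply: eW; rewrite /ball /= sub0r normrN ger0_norm ?divr_ge0 // 1?ltW //.
  by rewrite ltr_pdivrMr // ltr_pMr // ltr1n.
suff : (size [seq (t k)%:C%C | k <- iota 0 (size q)] < size q)%N.
  by rewrite size_map size_iota ltnn.
apply: max_poly_roots => //.
  apply/allP => _ /mapP[k _ ->]; rewrite /root; apply: contrapT => qk.
  by apply: Wroot; exists (t k) => //; exact/negP.
rewrite map_inj_uniq ?iota_uniq // => j k /(@complexI R).
by move=> /(mulfI (lt0r_neq0 e0))/invr_inj/eqP; rewrite eqr_nat => /eqP[].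
Qed.

(** Write [u] as [A + i B] with [f] nonzero at [u]. On the line [A + t B], [f] is nonzero at the
    parameter i, hence at some real one, which gives a real matrix [c]. On the line from [b] to [c]
    it is nonzero at parameter 1, hence at real parameters arbitrarily close to 0. *)
Lemma zariski_open_real_dense (R : realType) m n (U : set 'M[R[i]]_(m, n))
    (b : 'M[R]_(m, n)) (W : set 'M[R]_(m, n)) :
  U !=set0 -> zariski_open_mx U -> nbhs b W ->
  exists2 a, W a & U (complexify a).
Proof.
move=> [u Uu] [I UI] bW.
have [f If fu] : exists2 f, I f & peval f (mxvec u) != 0.
  apply: contrapT => nf.
  have : [set v | ~ U (vec_mx v)] (mxvec u).
    rewrite UI => f If; apply: contrapT => /eqP fu; apply: nf.
    by exists f.
  by rewrite /= mxvecK.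
have fU a : peval f (complexify (mxvec a)) != 0 -> U (complexify a).
  move=> fa; apply: contrapT => nU.
  have : [set v | ~ U (vec_mx v)] (complexify (mxvec a)).
    by rewrite /= /complexify map_mxvec mxvecK.
  by rewrite UI => /(_ _ If)/eqP; rewrite (negbTE fa).
pose A := map_mx (@complex.Re R) u; pose B := map_mx (@complex.Im R) u.
(* On a real line, one complex parameter with nonzero value excludes the zero polynomial. *)
have line_near0 (c d : 'M[R]_(m, n)) (t0 : R[i]) (V : set R) : nbhs 0 V ->
    peval f (complexify (mxvec c) + t0 *: complexify (mxvec d)) != 0 ->
    exists2 t, V t & peval f (complexify (mxvec (c + t *: d))) != 0.
  move=> V0.
  have [q [qE _]] := poly_line f (complexify (mxvec c)) (complexify (mxvec d)).
  rewrite -qE => qt0.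
  have q0 : q != 0 by apply: contraNneq qt0 => ->; rewrite horner0.
  have [t Vt qt] := poly_nonroot_near0 q0 V0; exists t => //.
  move: qt; rewrite qE; congr (peval f _ != 0).
  apply/rowP => l; case/mxvec_indexP: l => i j.
  by rewrite !mxE !mxvecE !mxE rmorphD rmorphM.
have [|t _ ft] := line_near0 A B 'i%C setT filterT.
  apply: contraNneq fu => <-; apply/eqP; congr peval.
  apply/rowP => l; case/mxvec_indexP: l => i j.
  by rewrite !mxE !mxvecE !mxE -complexE.
pose c := A + t *: B.
have [||s Ws fs] := line_near0 b (c - b) 1 [set s | W (b + s *: (c - b))].
- have : (fun s : R => b + s *: (c - b)) @ (0 : R) --> b + 0 *: (c - b).
    by apply: cvgD; [exact: cvg_cst|exact: scalel_continuous].
  by rewrite scale0r addr0; apply.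
- apply: contraNneq ft => <-; apply/eqP; congr peval.
  apply/rowP => l; case/mxvec_indexP: l => i j.
  by rewrite !mxE !mxvecE !mxE mul1r -rmorphD /= subrKC.
by exists (b + s *: (c - b)) => //; exact: fU.
Qed.

(** * Full rank as an open condition *)

Lemma rank_full_minor (K : fieldType) p n (M : 'M[K]_(p, n)) :
  \rank M = p <-> exists s : 'I_p -> 'I_n, \det (colsub s M) != 0.
Proof.
split=> [rM|[s sM]]; last first.
  apply/eqP; rewrite eqn_leq rank_leq_row /=.
  have rs : \rank (colsub s M) = p.
    by apply: mxrank_unit; rewrite unitmxE unitfE.
  apply: leq_trans (_ : (\rank (colsub s M) <= _)%N); first by rewrite rs.
  by rewrite -[M in colsub s M]mulmx1 -mulmx_colsub mxrankM_maxl.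
have fM : row_full M^T by rewrite /row_full mxrank_tr; exact/eqP.
exists (fullrankfun fM).
have := fullrowsub_unit fM.
by rewrite -unitmx_tr trmx_mxsub trmxK unitmxE unitfE.
Qed.

Definition real_jacobian (R : realType) n p (F : 'I_p -> poly_in n rat)
    (x : 'rV[R]_n) : 'M[R]_(p, n) :=
  \matrix_(k < p, l < n) peval (mpoly.mderiv l (rat_poly R (F k))) x.

(** The square of a nonzero maximal minor is a polynomial positive at [x], hence near [x]. *)
Lemma rank_real_jacobian_near (R : realType) n p (F : 'I_p -> poly_in n rat)
    (x : 'rV[R]_n) : \rank (real_jacobian F x) = p ->
  \forall y \near x, \rank (real_jacobian F y) = p.
Proof.
move=> /rank_full_minor[s sx].
pose g : poly_in n R := \det (colsub s
  (\matrix_(k < p, l < n) mpoly.mderiv l (rat_poly R (F k)))).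
have gE y : peval g y = \det (colsub s (real_jacobian F y)).
  rewrite /peval /g -det_map_mx; congr (\det _).
  by apply/matrixP => k l; rewrite !mxE.
have : 0 < peval (g ^+ 2) x.
  by rewrite /peval rmorphXn /= -/(peval g x) gE exprn_even_gt0.
move=> /peval_gt_near; apply: filterS => y.
rewrite /peval rmorphXn /= -/(peval g y) gE exprn_even_gt0 //= => sy.
by apply/rank_full_minor; exists s.
Qed.

(** * Minimising the squared distance on clopen parts *)

Definition sqdist_poly (R : comNzRingType) n (a : 'rV[R]_n) : poly_in n R :=
  \sum_l (mpoly.mpolyX R (mpoly.mnm1 l) - mpoly.mpolyC n (a 0 l)) ^+ 2.

Lemma peval_sqdist (R : comNzRingType) n (a x : 'rV[R]_n) :
  peval (sqdist_poly a) x = \sum_l (x 0 l - a 0 l) ^+ 2.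
Proof.
rewrite /peval raddf_sum /=; apply: eq_bigr => l _.
by rewrite rmorphXn /= mevalB mevalXU mevalC.
Qed.

Lemma peval_mderiv_sqdist (R : comNzRingType) n (a x : 'rV[R]_n) l :
  peval (mpoly.mderiv l (sqdist_poly a)) x = 2 * (x 0 l - a 0 l).
Proof.
rewrite /peval /sqdist_poly [mpoly.mderiv _ _]linear_sum [meval _ _]raddf_sum.
rewrite (bigD1 l) //= big1 => [|j jl];
  rewrite expr2 mderivM mevalD !mevalM mderivB mderivC subr0.
  rewrite mderivX mnm1E eqxx scale1r (_ : mnm_sub _ _ = mnm0).
    by rewrite mpolyX0 meval1 mevalB mevalXU mevalC; ring.
  by apply/mnmP => j; rewrite mnmBE subnn mnm0E.
by rewrite mderivX mnm1E (negbTE jl) scale0r meval0 mulr0 mul0r addr0.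
Qed.

Lemma lt_norm_of_sqr_lt (R : realDomainType) (c r : R) :
  0 <= r -> c ^+ 2 < r ^+ 2 -> `|c| < r.
Proof. by move=> r0; rewrite -real_normK ?num_real // ltr_pXn2r ?nnegrE. Qed.

(** Balls are those of the sup norm: each coordinate of [x] and of [z] is within [r / 2] of that of
    [a]. *)
Lemma sqdist_ball (R : realType) n (a x z : 'rV[R]_n) (r : R) : 0 < r ->
  peval (sqdist_poly a) x < (r / 2) ^+ 2 ->
  peval (sqdist_poly a) z <= peval (sqdist_poly a) x -> ball x r z.
Proof.
move=> r0 xa za.
have near_a y l :
    peval (sqdist_poly a) y < (r / 2) ^+ 2 -> `|y 0 l - a 0 l| < r / 2.
  move=> ya; apply: lt_norm_of_sqr_lt; first by rewrite divr_ge0 // ltW.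
  apply: le_lt_trans ya; rewrite peval_sqdist (bigD1 l) //= lerDl.
  by apply: sumr_ge0 => j _; exact: sqr_ge0.
split=> // i l; rewrite ord1 /ball /=.
have := near_a _ l xa; have := near_a _ l (le_lt_trans za xa).
rewrite !ltr_norml => /andP[] + + /andP[].
by move=> ? ? ? ?; apply/andP; split; lra.
Qed.

(* Lagrange's condition for the squared distance to the k0-th row of a makes
   that row of the polar matrix a combination of the gradients. *)
Lemma clopen_part_meets_polar (R : realType) n p m (f : 'I_p -> poly_in n R)
    (a : 'M[R]_(m, n)) (k0 : 'I_m) (x : 'rV[R]_n) (r : R) (B D : set 'rV[R]_n) :
  compact B -> closed B -> 0 < r -> ball x r `<=` B ->
  (forall k, peval (f k) x = 0) ->
  peval (sqdist_poly (row k0 a)) x < (r / 2) ^+ 2 ->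
  let K := B `&` [set y | forall k, peval (f k) y = 0] in
  D x -> closed D -> closed (K `\` D) ->
  D `&` [set y | forall s,
    peval (\det (colsub s (polar_poly f a))) y = 0] !=set0.
Proof.
move=> cB clB r0 rB fx xa K Dx cD cKD.
have Bx : B x by apply: rB; exact: ballxx.
have DKD : D `&` (K `\` D) = set0 by apply/seteqP; split => y // [? []].
have [U [V [oU oV DU KDV UV0]]] :=
  (@normal_openP R _).1 (@pseudometric_normal R _) _ _ cD cKD DKD.
have nV y : U y -> ~ V y.
  by move=> Uy Vy; have : (U `&` V) y by []; rewrite UV0.
(* Removing [V] from the box leaves a compact set whose common zeros of the [f k] all lie in [D].
   Those no farther from row [k0] than [x] stay in the ball, hence in the interior. *)
have [|||||||z [[Bz nVz] fz Qz limz]] := @penalty_limit R n p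
  (sqdist_poly (row k0 a)) f (B `&` ~` V) (U `&` ball x r) x.
- by apply: compact_closedI => //; exact: open_closedC.
- by apply: openI => //; exact: ball_open.
- by move=> y [Uy /rB By]; split => //; exact: nV.
- by split => //; apply: nV; exact: DU.
- exact: fx.
- by move=> y; rewrite peval_sqdist; apply: sumr_ge0 => l _; exact: sqr_ge0.
- move=> y [By nVy] fy Qy; split.
    by apply: DU; apply: contrapT => nDy; apply: nVy; exact: KDV.
  exact: sqdist_ball Qy.
exists z; split.
  by apply: contrapT => nDz; apply: nVz; exact: KDV.
(* A minor nonzero at [z] would have positive square near [z], in particular at a Lagrange point
   [y], where it vanishes. *)
move=> s; apply: contrapT => /eqP sz.
have : 0 < peval (\det (colsub s (polar_poly f a)) ^+ 2) z.
  by rewrite /peval rmorphXn /= exprn_even_gt0.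
move=> /peval_gt_near/limz[y sy [c cE]]; move: sy.
rewrite /= /peval rmorphXn /= -/(peval _ y).
(* The gradient of the squared distance at [y] is twice [y] minus row [k0]; hence the factor
   -1/2. *)
rewrite (@polar_minor_eq0 _ _ _ _ f a k0 y (fun k => - c k / 2));
  rewrite ?expr0n ?ltxx // => l.
have := cE l; rewrite peval_mderiv_sqdist mxE => cl.
have -> : a k0 l - y 0 l = - 2^-1 * (2 * (y 0 l - a k0 l)).
  by rewrite mulrA mulNr mulVf ?pnatr_eq0 // mulN1r opprB.
rewrite cl mulr_sumr; apply: eq_bigr => k _; rewrite mulrA.
by congr (_ * _); ring.
Qed.

(** * Real regular points and the choice of the open set *)

Lemma real_variety_eq0 (R : realType) n p (F : 'I_p -> poly_in n rat) :
  @real_variety R n p F = [set y | forall k, peval (rat_poly R (F k)) y = 0].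
Proof.
apply/seteqP; split => y yF k; have := yF k; rewrite qeval_complexify.
  by move=> /(@complexI R).
by move=> ->.
Qed.

Lemma regular_points_complexify (R : realType) n p (F : 'I_p -> poly_in n rat)
    (y : 'rV[R]_n) :
  regular_points F (complexify y) <->
  real_variety F y /\ \rank (real_jacobian F y) = p.
Proof. by rewrite /regular_points /= jacobian_complexify mxrank_map. Qed.

Lemma zariski_closure_sub (K : fieldType) N (A : set 'rV[K]_N) :
  A `<=` zariski_closure A.
Proof. by move=> y Ay Z [_]; exact. Qed.

Theorem theorem3 (R : realType) (n p i : nat)
  (hp : (1 <= p < n)%N) (hi : (1 <= i <= n - p)%N)
  (F : 'I_p -> poly_in n rat)
  (hF : reduced_regular_sequence F)
  (hI : ideal_first F p = ideal_of_definition (@variety R n p F))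
  (U : set 'M[R[i]]_(n - p - i + 1, n))
  (hU0 : U !=set0) (hUo : zariski_open_mx U)
  (hUr : forall a : 'M[R[i]]_(n - p - i + 1, n),
     U a -> \rank a = (n - p - i + 1)%N)
  (C : set 'rV[R]_n)
  (hC : is_connected_component (@real_variety R n p F) C)
  (hCreg : exists2 x : 'rV[R]_n, C x & regular_points F (complexify x)) :
  exists O : set 'M[R]_(n - p - i + 1, n),
    [/\ O !=set0, open O &
      forall a : 'M[R]_(n - p - i + 1, n), O a ->
        [/\ \rank a = (n - p - i + 1)%N,
            U (complexify a) &
            exists x : 'rV[R]_n,
              [/\ real_dual_polar_variety F a x,
                  regular_points F (complexify x) & C x]]].
Proof.
have [x Cx /regular_points_complexify[Sx rx]] := hCreg.
have {hC}-> : C = connected_component (@real_variety R n p F) x.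
  by move: hC Cx => [y _ ->]; exact: same_connected_component.
have [e /= e0 ereg] := (@nbhs_ballP _ _ _ _).1 (rank_real_jacobian_near rx).
(* Halving puts the closed box of radius [r] inside the open ball of radius [e]. *)
pose r := e / 2; have r0 : 0 < r by rewrite divr_gt0.
have k0 : 'I_(n - p - i + 1) by rewrite addn1; exact: ord0.
pose d (a : 'M[R]_(n - p - i + 1, n)) := peval (sqdist_poly x) (row k0 a).
have dC a : peval (sqdist_poly (row k0 a)) x = d a.
  by rewrite /d !peval_sqdist; apply: eq_bigr => l _; rewrite -sqrrN opprB.
have d_continuous : continuous d.
  apply: peval_continuous => l; under eq_fun do rewrite mxE.
  exact: coord_continuous.
(* The bound is the one that [sqdist_ball] requires. *)
pose O1 := [set a | d a < (r / 2) ^+ 2].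
have O1open : open O1.
  by apply: (@open_comp _ _ d [set t | t < (r / 2) ^+ 2]) => [a _|];
    [exact: d_continuous|exact: open_lt].
exists ([set a | U (complexify a)] `&` O1); split.
(* The matrix with all rows equal to [x] lies in [O1]; density provides a nearby one in [U]. *)
- have [|a O1a Ua] := @zariski_open_real_dense R _ _ U
    (\matrix_(k, l) x 0 l) O1 hU0 hUo.
    apply: open_nbhs_nbhs; split => //; rewrite /O1 /= /d peval_sqdist big1.
      by rewrite exprn_gt0 // divr_gt0.
    by move=> l _; rewrite !mxE subrr expr0n.
  by exists a.
- by apply: openI => //; exact: zariski_open_real_open.
move=> a [/= Ua da]; split => //.
  by have := hUr _ Ua; rewrite mxrank_map.
pose side l := `[x 0 l - r, x 0 l + r]%classic.
pose B := [set y : 'rV[R]_n | forall l, side l (y 0 l)].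
have cB : compact B.
  by apply: (@rV_compact _ _ side) => l; exact: segment_compact.
have hT : hausdorff_space 'rV[R]_n by exact: norm_hausdorff.
have clB : closed B by exact: compact_closed.
have Bx y : B y -> \rank (real_jacobian F y) = p.
  move=> By; apply: ereg; split => // j l; rewrite ord1 /ball /=.
  have := By l; rewrite /side /= in_itv /= => /andP[h1 h2].
  by rewrite ltr_norml; apply/andP; rewrite /r in r0 h1 h2; split; lra.
have rB : ball x r `<=` B.
  move=> y [_ /(_ 0)xy] l; have := xy l.
  rewrite /ball /side /= in_itv /= ltr_norml => /andP[h1 h2].
  by apply/andP; split; lra.
pose f k := rat_poly R (F k).
pose K := B `&` [set y | forall k, peval (f k) y = 0].
have fx : forall k, peval (f k) x = 0 by rewrite real_variety_eq0 in Sx.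
have clf : closed [set y | forall k, peval (f k) y = 0].
  exact: common_zeros_closed.
have cK : compact K by exact: compact_closedI.
have Kx : K x by split => //; apply: rB; exact: ballxx.
pose Z := [set y : 'rV[R]_n |
  forall s, peval (\det (colsub s (polar_poly f a))) y = 0].
have cZ : closed Z by exact: common_zeros_closed.
have [|y [Cy Zy]] := @component_meets_closed R _ K x hT
  (@pseudometric_normal R _) cK Kx Z cZ.
  move=> D DK Dx cD cKD.
  by apply: (@clopen_part_meets_polar R n p _ f a k0 x r B D) => //; rewrite dC.
have [By fy] := connected_component_sub Cy.
have Sy : regular_points F (complexify y).
  apply/regular_points_complexify; rewrite real_variety_eq0.
  by split => //; exact: Bx.
exists y; split => //.
- apply: zariski_closure_sub; split => // s _.
  rewrite polar_matrix_complexify /complexify.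
  rewrite -map_mxsub det_map_mx -map_mxsub det_map_mx.
  exact: (congr1 (real_complex R) (Zy s)).
(* A connected subset of [K] through [x] is also one of the real variety. *)
- case: Cy => E [Ex EK cE] Ey; exists E => //; split => // z /EK[_].
  by rewrite real_variety_eq0.
Qed.
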